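(* Let $\bar x\in X$ be a feasible point of the constraint system $G(x)=0$ (that is, $G(\bar x)=0$). Suppose that there are a neighborhood $U\subset X$ of $\bar x$ and some $\beta>0$ such that $\gamma(G'(x))\ge\beta$ for all $x\in U$. Then $\bar x$ is sw-AKKT regular.
   Context: Setting: $X$ and $Y$ are real Banach spaces and $G\colon X\to Y$ is continuously Fréchet differentiable. For a bounded linear operator $T\colon X\to Y$, the reduced minimum modulus is $\gamma(T):=\inf\{\|Tx\|_Y\mid x\in X,\ \operatorname{dist}(x,\ker T)=1\}$. For $x\in X$ and $r\ge0$ let $$\mathcal M(x,r):=\{G'(x)^*\lambda\in X^*\mid\lambda\in Y^*,\ -\langle\lambda,G(x)\rangle_Y\le r\}$$ (this is the set $\{G'(x)^*\lambda+\mu\mid\lambda\in Y^*,\ \mu\in\mathcal N_C(x),\ \langle\lambda,y-G(x)\rangle_Y\le r\ \forall y\in K\}$ for $C=X$ and $K=\{0\}$, where $\mathcal N_C(x)$ is the normal cone of convex analysis). A feasible point $\bar x$ is sw-AKKT regular if every $\bar v\in X^*$ for which there exist sequences $\{x^k\}\subset X$, $\{r^k\}\subset[0,+\infty)$, $\{v^k\}\subset X^*$ with $x^k\to\bar x$ (strongly), $r^k\to0$, $v^k\rightharpoonup^*\bar v$ (weak* ) and $v^k\in\mathcal M(x^k,r^k)$ for all $k$ belongs to $\mathcal M(\bar x,0)$. *)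

(* Defs.v *)
From HB Require Import structures.
From mathcomp Require Import all_boot all_order all_algebra.
From mathcomp Require Import all_classical all_reals all_analysis.

Set Implicit Arguments.
Unset Strict Implicit.
Unset Printing Implicit Defensive.

Import Order.TTheory GRing.Theory Num.Theory.
Import numFieldNormedType.Exports.

Local Open Scope classical_set_scope.
Local Open Scope ring_scope.

(* X^* as a set of functions; elements are compared extensionally. *)
Definition dual (R : realType) (X : normedModType R) : set (X -> R) :=
  [set f : X -> R | scalar f /\ continuous f].

Arguments dual {R} X.

Definition adjoint (R : realType) (X Y : normedModType R) (T : X -> Y)
  (lambda : Y -> R) : X -> R := lambda \o T.

Definition weak_star_cvg (R : realType) (X : normedModType R)
  (v_ : nat -> X -> R) (v : X -> R) : Prop :=
  forall h : X, v_ k h @[k --> \oo] --> v h.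

(* Valued in \bar R, so that an unbounded T has norm +oo. *)
Definition opnorm (R : realType) (X Y : normedModType R) (T : X -> Y) : \bar R :=
  ereal_sup [set `|T x|%:E | x in [set x : X | `|x| <= 1]].

Definition continuously_differentiable (R : realType) (X Y : normedModType R)
  (G : X -> Y) : Prop :=
  (forall x, differentiable G x) /\
  (forall x, opnorm ('d G y \- 'd G x) @[y --> x] --> 0%E).

(* edist_inf A x is the distance of x to A.  The infimum is taken in \bar R:
   it is +oo when T = 0, no point being then at distance 1 from the kernel. *)
Definition reduced_min_modulus (R : realType) (X Y : normedModType R)
  (T : {linear X -> Y}) : \bar R :=
  ereal_inf [set `|T x|%:E |
             x in [set x : X | edist_inf (T @^-1` [set 0]) x = 1%:E]].

(* M(x, r) for the constraint system G(x) = 0. *)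
Definition multiplier_set (R : realType) (X Y : normedModType R) (G : X -> Y)
  (x : X) (r : R) : set (X -> R) :=
  [set adjoint ('d G x) lambda |
   lambda in [set lambda | dual Y lambda /\ - lambda (G x) <= r]].

Definition sw_AKKT_regular (R : realType) (X Y : normedModType R) (G : X -> Y)
  (xbar : X) : Prop :=
  forall vbar : X -> R, dual X vbar ->
  (exists (x_ : nat -> X) (r_ : nat -> R) (v_ : nat -> X -> R),
    [/\ x_ @ \oo --> xbar,
        (forall k, 0 <= r_ k) /\ r_ @ \oo --> 0,
        (forall k, dual X (v_ k)) /\ weak_star_cvg v_ vbar
      & forall k, multiplier_set G (x_ k) (r_ k) (v_ k)]) ->
  multiplier_set G xbar 0 vbar.

(* Main.v *)
(* If [v_k = T_k^* lambda_k] with [T_k = G'(x_k)], then [v_k] vanishes on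
   [ker T_k], so that
   [|v_k h| <= |v_k| dist(h, ker T_k) <= (|v_k| / beta) |T_k h|].  The norms
   [|v_k|] are bounded by Banach-Steinhaus, and [T_k h --> T h] for
   [T = G'(xbar)]; in the limit [|v h| <= (C / beta) |T h|].  Hence
   [T h |-> v h] is a well-defined bounded functional on the range of [T], and
   any Hahn-Banach extension of it is the required multiplier.  This avoids
   extracting a weak* cluster point of the [lambda_k]. *)
Require Import Defs.
From HB Require Import structures.
From mathcomp Require Import all_boot all_order all_algebra.
From mathcomp Require Import all_classical all_reals all_analysis.
From mathcomp Require Import ring lra.

Set Implicit Arguments.
Unset Strict Implicit.
Unset Printing Implicit Defensive.

Import Order.TTheory GRing.Theory Num.Theory.
Import numFieldNormedType.Exports.

Local Open Scope classical_set_scope.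
Local Open Scope ring_scope.

(* Hahn-Banach for a dominated linear relation [A0], the graph of a functional
   on the projection of [A0] to [V].  Running Zorn on the graphs [A] through
   [A0 `|` A] lets the empty chain be bounded as well. *)
Lemma linear_relation_extension (R : realType) (V : lmodType R) (p : V -> R)
  (A0 : set (V * R)) :
  (forall u v, p (u + v) <= p u + p v) ->
  (forall t u, 0 <= t -> p (t *: u) = t * p u) ->
  A0 (0, 0) ->
  (forall k u v, A0 u -> A0 v -> A0 (k *: u.1 + v.1, k * u.2 + v.2)) ->
  (forall u, A0 u -> u.2 <= p u.1) ->
  exists2 f : V -> R, scalar f &
    (forall u, A0 u -> f u.1 = u.2) /\ (forall u, f u <= p u).
Proof.
move=> pD pZ A00 A0lin A0p.
pose lin (A : set (V * R)) := forall k u v, A u -> A v ->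
  A (k *: u.1 + v.1, k * u.2 + v.2).
pose dom (A : set (V * R)) := forall u, A u -> u.2 <= p u.1.
pose P A := lin (A0 `|` A) /\ dom (A0 `|` A).
have [F FP Ftot|A [[Alin Adom] Amax]] := @Zorn_bigcup _ P.
  split; last first.
    move=> u [/A0p //|[B FB Bu]].
    by apply: (FP _ FB).2; right.
  (* In each case both pairs lie in [A0] joined with a single member of the chain; totality of the
     chain provides it when [u] and [v] come from different members. *)
  move=> k u v [A0u|[B FB Bu]] [A0v|[C FC Cv]].
  - by left; exact: A0lin.
  - have [] := (FP _ FC).1 k u v; [by left|by right|by left|].
    by right; exists C.
  - have [] := (FP _ FB).1 k u v; [by right|by left|by left|].
    by right; exists B.
  - have [BC|CB] := Ftot _ _ FB FC.
    + have [] := (FP _ FC).1 k u v; [by right; exact: BC|by right|by left|].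
      by right; exists C.
    + have [] := (FP _ FB).1 k u v; [by right|by right; exact: CB|by left|].
      by right; exists B.
set B := A0 `|` A in Alin Adom.
have B0 : B (0, 0) by left.
have BZ k u : B u -> B (k *: u.1, k * u.2).
  by move=> Bu; have := Alin k _ _ Bu B0; rewrite /= !addr0.
(* Domination forces single-valuedness: [(y, a') - (y, b')] has first component 0, so
   [a' - b' <= p 0 = 0]. *)
have Bfun y a b : B (y, a) -> B (y, b) -> a = b.
  have le a' b' : B (y, a') -> B (y, b') -> a' <= b'.
    move=> Ba Bb; have /= := Adom _ (Alin (-1) _ _ Bb Ba).
    have -> : p (-1 *: y + y) = 0.
      by rewrite scaleN1r addNr -(scale0r (0 : V)) pZ// mul0r.
    lra.
  by move=> Ba Bb; apply/eqP; rewrite eq_le !le.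
have Btot y : exists a, B (y, a).
  (* A value [c] at [y] respects [p] when it lies above all of [S] and below every
     [p (v.1 + y) - v.2]. Subadditivity separates these two families, so [sup S] qualifies. *)
  pose S := [set u.2 - p (u.1 - y) | u in B].
  have Sub u v : B u -> B v -> u.2 - p (u.1 - y) <= p (v.1 + y) - v.2.
    move=> Bu Bv; have /= := Adom _ (Alin 1 _ _ Bu Bv).
    have := pD (u.1 - y) (v.1 + y).
    have -> : u.1 - y + (v.1 + y) = 1 *: u.1 + v.1.
      by rewrite scale1r addrACA addNr addr0.
    lra.
  have Sne : S !=set0 by exists (0 - p (0 - y)), (0, 0).
  have lec u : B u -> u.2 - p (u.1 - y) <= sup S.
    move=> Bu; apply: ub_le_sup; last by exists u.
    by exists (p (0 + y) - 0) => _ [v Bv <-]; apply: (Sub _ (0, 0)).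
  have cle v : B v -> sup S <= p (v.1 + y) - v.2.
    by move=> Bv; apply: ge_sup => // _ [u Bu <-]; exact: Sub.
  set c := sup S in lec cle.
  (* [E] adjoins the line through [(y, c)] to [B]. It is again linear and dominated, so maximality
     of [A] puts [(y, c)] in [A]. *)
  pose E := [set w | exists u t, B u /\ w = (u.1 + t *: y, u.2 + t * c)].
  have BE : B `<=` E.
    by move=> [u a] Bu; exists (u, a), 0; rewrite /= scale0r mul0r !addr0.
  have A0E : A0 `|` E = E by apply/setUidPr => u A0u; apply: BE; left.
  apply: contrapT => noa; apply: (Amax E).
    split; first by move=> u Au; apply: BE; right.
    move=> EA; apply: noa; exists c; right; apply: EA.
    by exists (0, 0), 1; rewrite /= scale1r mul1r !add0r.
  rewrite /P A0E; split.
    move=> k _ _ [u [t [Bu ->]]] [v [s [Bv ->]]] /=.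
    exists (k *: u.1 + v.1, k * u.2 + v.2), (k * t + s); split; first exact: Alin.
    congr pair => /=; last by ring.
    by rewrite scalerDr scalerDl addrACA scalerA.
  move=> _ [u [t [Bu ->]]] /=.
  (* By homogeneity, dividing by [|t|] reduces to [t = -1], which is [lec], or to [t = 1], which is
     [cle]. *)
  have [t0|t0|->] := ltgtP t 0; last by rewrite scale0r mul0r !addr0; exact: Adom.
  - have s0 : 0 < - t by rewrite oppr_gt0.
    have /= := lec _ (BZ (- t)^-1 _ Bu).
    rewrite -(ler_pM2l s0) mulrBr -(pZ _ _ (ltW s0)) mulrA divff ?gt_eqF// mul1r.
    rewrite scalerBr scalerA divff ?gt_eqF// scale1r scaleNr opprK; lra.
  - have /= := cle _ (BZ t^-1 _ Bu).
    rewrite -(ler_pM2l t0) mulrBr -(pZ _ _ (ltW t0)) mulrA divff ?gt_eqF// mul1r.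
    rewrite scalerDr scalerA divff ?gt_eqF// scale1r; lra.
pose f y := sval (cid (Btot y)).
have Bf y : B (y, f y) by rewrite /f; case: cid.
exists f; last split.
- by move=> k u v; apply: Bfun (Bf _) (Alin k _ _ (Bf u) (Bf v)).
- by move=> [u a] A0u /=; apply: Bfun (Bf _) _; left.
- by move=> u; exact: (Adom _ (Bf u)).
Qed.

(** * Distance to the kernel and the reduced minimum modulus *)

Lemma edistE (R : realType) (V : normedModType R) (x y : V) :
  edist (x, y) = `|x - y|%:E.
Proof.
apply/eqP; rewrite eq_le; apply/andP; split.
  apply/lee_addgt0Pr => e e0; rewrite -EFinD.
  apply: edist_fin => /=; first by rewrite ltr_wpDl.
  by rewrite -ball_normE /= ltrDl.
apply: le_ereal_inf_tmp => _ [r [_ xy] <-]; rewrite lee_fin.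
by move: xy; rewrite /= -ball_normE /= => /ltW.
Qed.

(** Each [a] competing for [x] yields the competitor [t *: a] for [t *: x]. For a cone, the reverse
    inequality is the same statement with factor [t^-1]. *)
Lemma edist_infZ_le (R : realType) (V : normedModType R) (A : set V) (t : R)
  (x : V) : 0 < t -> (forall a, A a -> A (t *: a)) ->
  (edist_inf A (t *: x) <= t%:E * edist_inf A x)%E.
Proof.
move=> t0 At; rewrite muleC -lee_pdivrMr//.
apply: le_ereal_inf_tmp => _ [a Aa <-].
rewrite lee_pdivrMr// muleC edistE -EFinM -{2}(gtr0_norm t0) -normrZ scalerBr.
by rewrite -edistE; apply: ereal_inf_lbound; exists (t *: a) => //; exact: At.
Qed.

Lemma scalar_le_reduced_min_modulus (R : realType) (X Y : normedModType R)
  (T : {linear X -> Y}) (w : X -> R) (beta C : R) (x : X) :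
  0 < beta -> (beta%:E <= reduced_min_modulus T)%E ->
  scalar w -> (forall z, T z = 0 -> w z = 0) -> (forall z, `|w z| <= C * `|z|) ->
  beta * `|w x| <= C * `|T x|.
Proof.
move=> beta0 gammaT lw wT wC; set K := T @^-1` [set 0].
have KZ t a : K a -> K (t *: a).
  by rewrite /K /= => Ta; rewrite linearZ /= Ta scaler0.
have wK a : K a -> `|w x| <= C * `|x - a|.
  move=> Ka; apply: le_trans (wC _).
  have -> : x - a = -1 *: a + x by rewrite scaleN1r addrC.
  by rewrite lw (wT a)// mulr0 add0r.
(* The sign of [C] is not given: on a trivial space a negative [C] satisfies [wC]. *)
have Cge0 : x != 0 -> 0 <= C.
  move=> x0; have := le_trans (normr_ge0 _) (wC x).
  by rewrite pmulr_lge0 ?normr_gt0.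
have [->|x0] := eqVneq x 0.
  have -> : w 0 = 0 by rewrite wT// linear0.
  by rewrite linear0 !normr0 !mulr0.
have dfin : edist_inf K x \is a fin_num.
  rewrite ge0_fin_numE ?edist_inf_ge0//; apply: (@le_lt_trans _ _ (edist (x, 0 : X))).
    by apply: ereal_inf_lbound; exists 0 => //=; rewrite /K /= linear0.
  by rewrite edistE ltry.
have [d dE] : exists d, edist_inf K x = d%:E.
  by exists (fine (edist_inf K x)); rewrite fineK.
have d0 : 0 <= d by rewrite -lee_fin -dE edist_inf_ge0.
have wd : `|w x| <= C * d.
  apply/ler_addgt0Pr => e e0.
  (* The slack [e / (C + 1)] costs at most [e] after multiplication by [C], and makes sense for
     [C = 0]. *)
  have C1 : 0 < C + 1 by rewrite ltr_wpDl// Cge0.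
  have eC : 0 < e / (C + 1) by rewrite divr_gt0.
  have [_ [a Ka <-]] := lb_ereal_inf_adherent eC dfin.
  rewrite -/(edist_inf K x) dE edistE -EFinD lte_fin => /ltW xa.
  apply: (le_trans (wK _ Ka)); apply: (le_trans (ler_wpM2l (Cge0 x0) xa)).
  by rewrite mulrDr lerD2l mulrA ler_pdivrMr// mulrC ler_pM2l// ler_wpDr//.
(* A point at distance 0 cannot be rescaled to distance 1, but there [wd] gives [w x = 0]. *)
move: d0; rewrite le_eqVlt => /predU1P[d0|d0].
  have -> : `|w x| = 0.
    by apply/eqP; rewrite eq_le normr_ge0 andbT (le_trans wd)// -d0 mulr0.
  by rewrite mulr0 mulr_ge0// Cge0.
have d1 : edist_inf K (d^-1 *: x) = 1%:E.
  apply/eqP; rewrite eq_le; apply/andP; split.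
    apply: (le_trans (edist_infZ_le _ _ _)); rewrite ?invr_gt0//; first exact: KZ.
    by rewrite dE -EFinM mulVf ?gt_eqF.
  rewrite -(@lee_pmul2l _ d%:E)// mule1 -{1}dE.
  rewrite -{1}[x]scale1r -(divff (lt0r_neq0 d0)) -scalerA.
  by apply: edist_infZ_le => //; exact: KZ.
have : beta * d <= `|T x|.
  rewrite -ler_pdivlMr// -lee_fin; apply: (le_trans gammaT).
  apply: ereal_inf_lbound; exists (d^-1 *: x) => //.
  by rewrite linearZ /= normrZ gtr0_norm ?invr_gt0// mulrC.
move=> bd; apply: (@le_trans _ _ (C * (beta * d))); last by rewrite ler_wpM2l// Cge0.
by rewrite mulrCA ler_pM2l.
Qed.

(** * Operator norms and bounded functionals *)

Lemma opnorm_le (R : realType) (X Y : normedModType R) (T : {linear X -> Y})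
  (e : R) (h : X) : (opnorm T <= e%:E)%E -> `|T h| <= e * `|h|.
Proof.
move=> Te; have [->|h0] := eqVneq h 0; first by rewrite linear0 !normr0 mulr0.
have nh : 0 < `|h| by rewrite normr_gt0.
rewrite -ler_pdivrMr// -lee_fin; apply: le_trans Te.
apply: ereal_sup_ubound; exists (`|h|^-1 *: h).
  by rewrite /= normrZ gtr0_norm ?invr_gt0// mulVf ?gt_eqF.
by rewrite linearZ /= normrZ gtr0_norm ?invr_gt0// mulrC.
Qed.

Lemma continuously_differentiable_diff_cvg (R : realType) (X Y : normedModType R)
  (G : X -> Y) (x h : X) :
  continuously_differentiable G -> 'd G y h @[y --> x] --> 'd G x h.
Proof.
move=> [_ /(_ x) Gx]; apply/cvgrPdist_le => e e0.
have h1 : 0 < `|h| + 1 by rewrite ltr_wpDl.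
have eh : 0 < e / (`|h| + 1) by rewrite divr_gt0.
have : \forall y \near x, (opnorm ('d G y \- 'd G x)%R < (e / (`|h| + 1))%:E)%E.
  apply: (Gx [set z | (z < (e / (`|h| + 1))%:E)%E]).
  by apply: open_nbhs_nbhs; split; [exact: open_ereal_lt_ereal|rewrite /= lte_fin].
apply: filterS => y /= /ltW Gye.
have := @opnorm_le _ _ _ ('d G y \- 'd G x) _ h Gye => /=.
rewrite distrC => /le_trans; apply.
by rewrite mulrAC ler_pdivrMr// ler_pM2l// lerDl.
Qed.

(** A one-sided bound, as delivered by Hahn-Banach, suffices: at [- x] it bounds [f] from below. *)
Lemma dual_le (R : realType) (X : normedModType R) (f : X -> R) (C : R) :
  scalar f -> (forall x, f x <= C * `|x|) -> dual X f.
Proof.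
move=> lf fC; split => //.
pose g : {linear X -> R^o} := HB.pack f (GRing.isLinear.Build _ _ _ _ _ lf).
apply: (@bounded_linear_continuous _ _ _ g); apply/linear_boundedP.
near=> r => x; apply: (@le_trans _ _ (C * `|x|)).
  by rewrite ler_norml fC andbT lerNl -(linearN g) -normrN; exact: fC.
by rewrite ler_wpM2r//; near: r; exact: nbhs_pinfty_ge.
Unshelve. all: by end_near. Qed.

Lemma weak_star_cvg_bounded (R : realType) (X : completeNormedModType R)
  (v_ : nat -> X -> R) (v : X -> R) :
  (forall k, dual X (v_ k)) -> weak_star_cvg v_ v ->
  exists C, forall k x, `|v_ k x| <= C * `|x|.
Proof.
move=> dv vv.
(* The radius 1 makes [M] a common bound on the unit ball; pointwise boundedness holds because each
   [v_ k x] converges. *)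
have [f|x|M vM] := @Banach_Steinhauss R X R^o (range v_) _ _ 1.
- move=> [k _ <-]; have [lk ck] := dv k; split => //.
  pose g : {linear X -> R^o} := HB.pack (v_ k) (GRing.isLinear.Build _ _ _ _ _ lk).
  by apply/(bounded_funP g)/(linear_bounded_continuous g).
- have [M [_ vM]] : bounded_fun (v_ ^~ x).
    by apply: cvg_seq_bounded; apply/cvg_ex; exists (v x); exact: vv.
  exists (M + 1) => _ [k _ <-]; apply: (vM (M + 1)) => //.
  by rewrite ltrDl.
exists M => k x; have [lk _] := dv k.
pose g : {linear X -> R^o} := HB.pack (v_ k) (GRing.isLinear.Build _ _ _ _ _ lk).
have [->|x0] := eqVneq x 0; first by rewrite (linear0 g : v_ k 0 = 0) !normr0 mulr0.
have nx : 0 < `|x| by rewrite normr_gt0.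
have := vM (v_ k) (imageP _ I) (`|x|^-1 *: x).
rewrite (linearZ_LR g : forall a u, v_ k (a *: u) = a * v_ k u).
rewrite normrZ normrM gtr0_norm ?invr_gt0// mulVf ?gt_eqF//.
by move=> /(_ (lexx _)); rewrite mulrC ler_pdivrMr.
Qed.

(** * Passage to the limit and construction of the multiplier *)

Theorem proposition6p1 (R : realType) (X Y : completeNormedModType R)
  (G : X -> Y) (hG : continuously_differentiable G)
  (xbar : X) (hxbar : G xbar = 0)
  (U : set X) (hU : nbhs xbar U) (beta : R) (hbeta : 0 < beta)
  (hgamma : forall x, U x -> (beta%:E <= reduced_min_modulus ('d G x))%E) :
  sw_AKKT_regular G xbar.
Proof.
move=> v [lv cv] [x_ [r_ [v_ [xx _ [dv vv] vM]]]].
have [C vC] := weak_star_cvg_bounded dv vv.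
have vT h : beta * `|v h| <= C * `|'d G xbar h|.
  have lcvg : beta * `|v_ k h| @[k --> \oo] --> beta * `|v h|.
    by apply: cvgMr; apply: cvg_norm; exact: vv.
  have rcvg : C * `|'d G (x_ k) h| @[k --> \oo] --> C * `|'d G xbar h|.
    apply: cvgMr; apply: cvg_norm.
    apply: (@cvg_comp _ _ _ x_ (fun y => 'd G y h) _ (nbhs xbar)) => //.
    exact: continuously_differentiable_diff_cvg.
  apply: ler_cvg_to lcvg rcvg _.
  have : \forall k \near \oo, U (x_ k) by apply: xx.
  apply: filterS => k Uk; apply: scalar_le_reduced_min_modulus => //.
  - exact: hgamma.
  - by case: (dv k).
  - move=> z Tz; have [l [[ll _] _] <-] := vM k.
    pose g : {linear Y -> R^o} := HB.pack l (GRing.isLinear.Build _ _ _ _ _ ll).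
    by rewrite /adjoint /= Tz; exact: (linear0 g).
(* The absolute value of [C] keeps [p] sublinear whatever the sign of [C]. *)
pose p (y : Y) := (`|C| / beta) * `|y|.
(* As a relation, [A0] needs no choice of preimages under ['d G xbar]. *)
pose A0 := [set u : Y * R | exists h, u = ('d G xbar h, v h)].
pose g : {linear X -> R^o} := HB.pack v (GRing.isLinear.Build _ _ _ _ _ lv).
have [|||||l ll [lv' lp]] := @linear_relation_extension R Y p A0.
- by move=> u w; rewrite /p -mulrDr ler_wpM2l ?ler_normD// divr_ge0// ltW.
- by move=> t u t0; rewrite /p normrZ ger0_norm// mulrCA.
- by exists 0; rewrite linear0 (linear0 g : v 0 = 0).
- move=> k _ _ [h ->] [h' ->] /=; exists (k *: h + h').
  by rewrite linearP lv.
- move=> _ [h ->] /=; apply: (le_trans (ler_norm _)).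
  rewrite /p mulrAC ler_pdivlMr// mulrC; apply: (le_trans (vT h)).
  by rewrite ler_wpM2r// ler_norm.
exists l; first split; first exact: dual_le ll lp.
  have -> : l (G xbar) = 0 by rewrite hxbar; apply: (lv' (0, 0)); exists 0;
    rewrite linear0 (linear0 g : v 0 = 0).
  by rewrite oppr0.
by apply/funext => h; apply: (lv' ('d G xbar h, v h)); exists h.
Qed.
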